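(* For all integers $n\geq 1$ and $p\geq 0$, \[ B_{n,p}=(p+1)\sum_{k=1}^{n}\left\{ {n \atop k}\right\} \frac{(-1)^{n+k+1}\,k!}{(k+p)(k+p+1)}. \] In particular, for $p=0$, \[ B_{n}=\sum_{k=1}^{n}\left\{ {n \atop k}\right\} \frac{(-1)^{n+k+1}(k-1)!}{k+1}. \]
   Context: $\left\{ {n \atop k}\right\}$ denotes the Stirling number of the second kind. For each integer $p\geq 0$, the $p$-Bernoulli numbers $B_{n,p}$ ($n\geq 0$) are defined by $B_{0,p}=1$ and $B_{n+1,p}=pB_{n,p}-\frac{(p+1)^{2}}{p+2}B_{n,p+1}$ for $n,p\geq 0$; equivalently $\sum_{n\ge 0}B_{n,p}\frac{t^n}{n!}=(p+1)\int_{-1}^{0}\frac{(1+y)^p}{1-y(e^t-1)}\,dy$. For $p=0$, $B_{n,0}=B_n$ are the classical Bernoulli numbers, $\sum_{n\ge0}B_nt^n/n!=t/(e^t-1)$ (so $B_1=-1/2$). *)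

(* Defs.v *)
From mathcomp Require Import all_boot all_order all_algebra.
From mathcomp Require Import ring.

Set Implicit Arguments.
Unset Strict Implicit.
Unset Printing Implicit Defensive.

Import Order.TTheory GRing.Theory Num.Theory.
Local Open Scope ring_scope.

(* Number of partitions of an n-element set into k nonempty blocks
   ([partition] excludes the empty block). *)
Definition stirling2 (n k : nat) : nat :=
  #|[set P : {set {set 'I_n}} | partition P [set: 'I_n] & #|P| == k]|.

Fixpoint pBernoulli (n p : nat) : rat :=
  if n is m.+1 then
    p%:R * pBernoulli m p - p.+1%:R ^+ 2 / p.+2%:R * pBernoulli m p.+1
  else 1.

(* [:: B_0; ...; B_(n-1)], by course-of-values recursion on
   \sum_(k <= n) 'C(n+1, k) B_k = [n = 0]. *)
Fixpoint bernoulli_seq (n : nat) : seq rat :=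
  if n is m.+1 then
    let s := bernoulli_seq m in
    rcons s (((m == 0)%N%:R - \sum_(k < m) 'C(m.+1, k)%:R * s`_k) / m.+1%:R)
  else [::].

(* Classical Bernoulli numbers, with B_1 = -1/2; see [bernoulli_egf]. *)
Definition bernoulli (n : nat) : rat := (bernoulli_seq n.+1)`_n.

Lemma size_bernoulli_seq n : size (bernoulli_seq n) = n.
Proof. by elim: n => //= n IHn; rewrite size_rcons IHn. Qed.

Lemma nth_bernoulli_seq n k : (k < n)%N -> (bernoulli_seq n)`_k = bernoulli k.
Proof.
elim: n => // n IHn; rewrite ltnS leq_eqVlt => /predU1P[-> //|lt_kn].
by rewrite /= nth_rcons size_bernoulli_seq lt_kn IHn.
Qed.

Lemma bernoulli_rec n :
  \sum_(k < n.+1) 'C(n.+1, k)%:R * bernoulli k = (n == 0)%N%:R.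
Proof.
rewrite big_ord_recr /= [bernoulli n]/bernoulli /= nth_rcons size_bernoulli_seq.
rewrite ltnn eqxx binSn [X in _ + X]mulrC divfK ?pnatr_eq0 //.
rewrite (eq_bigr (fun k : 'I_n => 'C(n.+1, k)%:R * (bernoulli_seq n)`_k)).
  by rewrite addrC subrK.
by move=> k _; rewrite nth_bernoulli_seq.
Qed.

(* The coefficients of e^t - 1. *)
Definition expm1_coef (n : nat) : rat := if n is 0 then 0 else n`!%:R^-1.

(* (\sum_n B_n t^n / n!) (e^t - 1) = t as formal power series. *)
Lemma bernoulli_egf n :
  \sum_(k < n.+1) bernoulli k / k`!%:R * expm1_coef (n - k) = (n == 1)%N%:R.
Proof.
case: n => [|n]; first by rewrite big_ord_recr big_ord0 /= mulr0 addr0.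
rewrite big_ord_recr /= subnn mulr0 addr0.
have nz m : m`!%:R != 0 :> rat by rewrite pnatr_eq0 -lt0n fact_gt0.
apply: (mulfI (nz n.+1)); rewrite mulr_sumr.
transitivity ((n == 0)%N%:R : rat); last by case: n => [|n]; rewrite ?mulr0 ?mulr1.
rewrite -bernoulli_rec; apply: eq_bigr => k _.
have le_kn : (k <= n.+1)%N by rewrite ltnW.
have -> : expm1_coef (n.+1 - k) = (n.+1 - k)`!%:R^-1.
  by rewrite subSn // -ltnS.
by rewrite -(bin_fact le_kn) !natrM mulrA; field; rewrite !nz.
Qed.

(* Main.v *)
(* Applied to a sum over k of S(n+1, k) c(k), the recurrence of the Stirling
   numbers gives the sum of S(n, k) (k c(k) + c(k+1)); hence a sum of S(n, k)
   c(n, p, k) satisfies the recurrence of the p-Bernoulli numbers as soon as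
   its coefficients do so for each k.  Both the claimed coefficients and
   (-1)^k k!^2 (p+1)! / (k+p+1)! pass this test.  For p = 0 the latter are
   (-1)^k k! / (k+1), and summing them against binomial coefficients with
   sum_(k <= n) C(n+1, k) S(k, j) = (j+1) S(n+1, j+1) yields the recurrence of
   the classical Bernoulli numbers, so that B_n = B_(n,0). *)

Require Import Defs.
From mathcomp Require Import all_boot all_order all_algebra.
From mathcomp Require Import ring.

Set Implicit Arguments.
Unset Strict Implicit.
Unset Printing Implicit Defensive.

Import Order.TTheory GRing.Theory Num.Theory.
Local Open Scope ring_scope.

(** * Set partitions and the recurrence of the Stirling numbers *)

Lemma setD1_id (T : finType) (x : T) (A : {set T}) : x \notin A -> A :\ x = A.
Proof. by move=> xA; apply/setDidPl; rewrite disjoint_sym disjoints1. Qed.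

(** With F the indicator of a given number of parts, this becomes the recurrence of the Stirling
    numbers. *)
Lemma sum_partitionU1 (T : finType) (x : T) (D : {set T}) (F : nat -> nat) :
  x \notin D ->
  (\sum_(P : {set {set T}} | partition P (x |: D)) F #|P| =
  \sum_(P : {set {set T}} | partition P D) (F #|P|.+1 + #|P| * F #|P|))%N.
Proof.
move=> xD.
(* A partition of x |: D amounts to a partition Q of D with the part B of Q
   that receives x, where B = set0 means that x forms a part of its own. *)
pose ins (u : {set {set T}} * {set T}) := (x |: u.2) |: (u.1 :\ u.2).
pose del (P : {set {set T}}) :=
  (((pblock P x :\ x) |: (P :\ pblock P x)) :\ set0, pblock P x :\ x).
pose valid u := partition u.1 D && (u.2 \in set0 |: u.1).
have sub u : valid u -> u.2 \subset D.
  case/andP=> pD; rewrite in_setU1 => /predU1P[->|]; first exact: sub0set.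
  exact: partitionS.
have xNsub u : valid u -> x \notin u.2.
  by move=> vu; apply: contra xD; apply/subsetP/sub.
have xNblock Q C : partition Q D -> C \in Q -> x \notin C.
  by move=> pQ QC; apply: contra xD; apply/subsetP/(partitionS pQ QC).
have insP u : valid u -> partition (ins u) (x |: D).
  move=> vu; have sD := sub u vu; have xN := xNsub u vu.
  have -> : x |: D = (x |: u.2) :|: (D :\: u.2).
    apply/setP=> y; rewrite !inE; case: (y == x) => //=.
    by case: (boolP (y \in u.2)) => //= /(subsetP sD).
  apply: partitionU1; last 1 first.
  - rewrite disjoint_sym disjoints_subset; apply/subsetP=> y; rewrite !inE.
    by case/andP=> /negPf-> yD; rewrite orbF; apply: contraNneq xD => <-.
  - case/andP: vu => pD; rewrite in_setU1 => /predU1P[->|]; last first.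
      exact: partitionD1.
    by rewrite setD0 setD1_id // (partition0 pD).
  by apply/set0Pn; exists x; rewrite setU11.
have pblock_ins u : valid u -> pblock (ins u) x = x |: u.2.
  move=> vu; apply: def_pblock; rewrite ?setU11 //.
  exact: partition_trivIset (insP u vu).
have insK u : valid u -> del (ins u) = u.
  move=> vu; rewrite /del pblock_ins // setU1K ?xNsub //.
  case: u vu => Q B vu; have xN := xNsub _ vu; case/andP: (vu) => /= pQ QB.
  congr (_, _); rewrite /ins /= setU1K; last first.
    rewrite in_setD1; apply/negP=> /andP[_] /(xNblock Q _ pQ).
    by rewrite setU11.
  apply/setP=> C; rewrite !inE; case: (eqVneq C set0) => [->|nzC] /=.
    by rewrite (partition0 pQ).
  case: eqVneq => //= eqC; move: QB; rewrite in_setU1 -eqC.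
  by rewrite (negPf nzC) /=.
have card_ins u : valid u -> #|ins u| = ((u.2 == set0) + #|u.1|)%N.
  case: u => Q B vu; have xN := xNsub _ vu; case/andP: (vu) => /= pQ QB.
  rewrite /ins /= cardsU1 in_setD1.
  have -> : x |: B \in Q = false.
    by apply/negP=> /(xNblock Q _ pQ); rewrite setU11.
  rewrite andbF /=; move: QB; rewrite in_setU1.
  case: eqVneq => [->|_] /= QB; first by rewrite setD1_id // (partition0 pQ).
  by rewrite [RHS](cardsD1 B) QB.
have delP P : partition P (x |: D) -> valid (del P) /\ ins (del P) = P.
  move=> pP; have xP : x \in cover P by rewrite (cover_partition pP) setU11.
  set B := pblock P x; have PB : B \in P by apply: pblock_mem.
  have Bx : x \in B by rewrite mem_pblock.
  have BD : B \subset x |: D by apply: partitionS PB.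
  have p0 := partition0 pP.
  have pP' := partitionD1 pP PB.
  have sBD : B :\ x \subset D.
    apply/subsetP=> y /setD1P[yx /(subsetP BD)].
    by rewrite in_setU1 (negPf yx).
  (* A nonempty [B :\ x] that was itself a part would share its elements with B. So adding it to the
     other parts causes no collision, and [ins] can take it out again. *)
  have BP' : B :\ x \notin P :\ B \/ B :\ x = set0.
    case: (set_0Vmem (B :\ x)) => [|[y yB]]; [by right | left].
    apply/negP=> /setD1P[neB PBx]; case/negP: neB; apply/eqP.
    rewrite -(def_pblock (partition_trivIset pP) PBx yB).
    by apply: def_pblock (partition_trivIset pP) PB _; case/setD1P: yB.
  have defD : (B :\ x) :|: ((x |: D) :\: B) = D.
    apply/setP=> y; rewrite !inE; case: (eqVneq y x) => [->|yx] /=.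
      by rewrite Bx (negPf xD).
    case: (boolP (y \in B)) => //= yB; move/(subsetP BD): (yB).
    by rewrite in_setU1 (negPf yx) /= => ->.
  split; last first.
    rewrite /ins /del /= setD1K // -[RHS](setD1K PB); congr (_ |: _).
    apply/setP=> C; rewrite !inE.
    case: (eqVneq C (B :\ x)) => [->|_] /=.
      by case: BP' => [|->]; rewrite ?p0 ?andbF // in_setD1 => /negPf.
    by case: eqVneq => [->|] //=; rewrite p0 andbF.
  rewrite /valid /del /= -/B; apply/andP; split; last first.
    by rewrite !inE eqxx /= andbT orbN.
  (* If x is alone in its part, the empty remainder is discarded by [:\ set0]; otherwise it is a
     part of D. *)
  have [B0|nzB] := eqVneq (B :\ x) set0.
    rewrite B0 setU1K ?in_setD1 ?p0 ?andbF //.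
    by move: defD; rewrite B0 set0U => <-.
  rewrite setD1_id; last by rewrite !inE p0 andbF eq_sym (negPf nzB).
  rewrite -defD; apply: partitionU1 => //.
  rewrite disjoint_sym disjoints_subset; apply/subsetP=> y; rewrite !inE.
  by case/andP=> /negPf-> _; rewrite andbF.
rewrite (reindex_onto ins del) => [|P /delP[]] //=.
rewrite (eq_bigl valid) => [|u]; last first.
  apply/andP/idP=> [[/delP[v _] /eqP<-] //|vu].
  by rewrite insP // insK.
under eq_bigr => u /card_ins-> do [].
rewrite -(pair_big_dep (fun P => partition P D) (fun P B => B \in set0 |: P)
  (fun P B => F ((B == set0) + #|P|)%N)) /=.
apply: eq_bigr => P pP; have p0 := partition0 pP.
(* The choice [set0] gives one part more; each of the [#|P|] other choices leaves the number of
   parts unchanged. *)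
rewrite big_setU1 ?p0 //= eqxx add1n; congr (_ + _).
rewrite -sum_nat_const; apply: eq_bigr => B PB.
by rewrite (negPf (partition_neq0 pP PB)).
Qed.

Fixpoint stirling2_rec (n k : nat) : nat :=
  match n, k with
  | 0, 0 => 1
  | n'.+1, k'.+1 => (k'.+1 * stirling2_rec n' k'.+1 + stirling2_rec n' k')%N
  | _, _ => 0
  end.

Arguments stirling2_rec : simpl never.

Lemma stirling2_recSS n k :
  stirling2_rec n.+1 k.+1 =
  (k.+1 * stirling2_rec n k.+1 + stirling2_rec n k)%N.
Proof. by []. Qed.

Lemma stirling2_rec_small n k : (n < k)%N -> stirling2_rec n k = 0%N.
Proof.
elim: n k => [|n IHn] [|k] //; rewrite ltnS => lt_nk.
by rewrite stirling2_recSS !IHn ?muln0 // ltnW.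
Qed.

(** Arbitrary finite sets replace ['I_n] so that the induction can remove an element and stay in the
    same type. *)
Lemma card_partitions (T : finType) (D : {set T}) (k : nat) :
  #|[set P : {set {set T}} | partition P D & #|P| == k]| =
  stirling2_rec #|D| k.
Proof.
have cardE (E : {set T}) j :
    #|[set P : {set {set T}} | partition P E & #|P| == j]| =
    (\sum_(P : {set {set T}} | partition P E) (#|P| == j))%N.
  rewrite -sum1_card big_mkcond [RHS]big_mkcond /=.
  by apply: eq_bigr => P _; rewrite inE; case: partition; case: eqP.
move cardD: #|D| => n.
elim: n D cardD k => [|n IHn] D cardD k; rewrite cardE.
  rewrite (big_pred1 set0) => [|P]; last first.
    by rewrite (cards0_eq cardD) partition_set0.
  by rewrite cards0; case: k.
have [x xD] : exists x, x \in D by apply/set0Pn; rewrite -card_gt0 cardD.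
rewrite -(setD1K xD) (sum_partitionU1 (fun m => (m == k) : nat)) ?setD11 //.
have {}cardD : #|D :\ x| = n by move: cardD; rewrite (cardsD1 x) xD => -[].
rewrite big_split /=; case: k => [|k].
  by rewrite !big1 // => P _; case: eqP => [->|_]; rewrite ?mul0n ?muln0.
rewrite addnC stirling2_recSS -!(IHn (D :\ x)) // !cardE big_distrr /=.
congr (_ + _)%N.
by apply: eq_bigr => P _; case: eqP => [->//|_]; rewrite !muln0.
Qed.

Lemma stirling2E n k : stirling2 n k = stirling2_rec n k.
Proof. by rewrite /stirling2 card_partitions cardsT card_ord. Qed.

(** * Sums against Stirling numbers *)

Lemma stirling2_sumS (n : nat) (c : nat -> rat) :
  \sum_(k < n.+2) (stirling2_rec n.+1 k)%:R * c k =
  \sum_(k < n.+1) (stirling2_rec n k)%:R * (k%:R * c k + c k.+1).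
Proof.
rewrite big_ord_recl mul0r add0r.
under eq_bigr => k _ do
  rewrite lift0 stirling2_recSS natrD natrM mulrDl -mulrA mulrCA.
under [RHS]eq_bigr => k _ do rewrite mulrDr.
rewrite !big_split /=; congr (_ + _).
(* The two sums differ by a shift of index: the last term on the left has S(n, n+1) = 0, the first
   on the right has the factor k = 0. *)
rewrite big_ord_recr big_ord_recl /= (stirling2_rec_small (ltnSn n)).
by rewrite !mul0r mulr0 addr0 add0r; apply: eq_bigr.
Qed.

(** Combinatorially, k counts the elements outside the block of the added element. The proof is an
    induction on n by Pascal's rule. *)
Lemma sum_bin_stirling2 n j :
  \sum_(k < n.+1) 'C(n, k)%:R * (stirling2_rec k j)%:R =
  (stirling2_rec n.+1 j.+1)%:R :> rat.
Proof.
elim: n j => [|n IHn] j.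
  by rewrite big_ord1 mul1r stirling2_recSS /= muln0.
rewrite big_ord_recl bin0 mul1r.
under eq_bigr => k _ do rewrite lift0 binS natrD mulrDl.
rewrite big_split /= addrA.
rewrite [X in _ + X + _]big_ord_recr /= bin_small // mul0r addr0.
have -> : (stirling2_rec 0 j)%:R +
    \sum_(i < n) 'C(n, i.+1)%:R * (stirling2_rec i.+1 j)%:R
    = (stirling2_rec n.+1 j.+1)%:R :> rat.
  by rewrite -IHn big_ord_recl bin0 mul1r.
case: j => [|j].
  rewrite big1 ?addr0 => [|k _]; last by rewrite mulr0.
  by rewrite [in RHS]stirling2_recSS mul1n addn0.
under eq_bigr => k _ do rewrite stirling2_recSS natrD natrM mulrDr mulrCA.
rewrite big_split /= -mulr_sumr !IHn.
by rewrite [in RHS]stirling2_recSS natrD natrM -natr1; ring.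
Qed.

(** The choice c(j) = -(-1)^j (j-1)! makes j c(j) + c(j+1) vanish for j >= 1, so [stirling2_sumS]
    leaves only S(n, 0) c(1). *)
Lemma sum_alt_stirling2 n :
  \sum_(j < n.+1) (stirling2_rec n.+1 j.+1)%:R * ((-1) ^+ j * j`!%:R) =
  (n == 0)%:R :> rat.
Proof.
have := stirling2_sumS n (fun j => - (-1) ^+ j * (j.-1)`!%:R).
rewrite big_ord_recl mul0r add0r.
under eq_bigr => j _ do rewrite lift0 exprS mulN1r opprK /=.
move=> ->; rewrite big_ord_recl big1 ?addr0 => [|j _].
  by rewrite mul0r add0r expr1 opprK mul1r mulr1; case: n.
rewrite lift0 /= factS natrM !exprS; ring.
Qed.

(** * Stirling expansions of the Bernoulli and p-Bernoulli numbers *)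

(** [bernoulliE] uses the case p = 0; the induction on n runs over all p, since the recurrence
    passes from p to p + 1. *)
Lemma pBernoulli_stirling2 n p :
  pBernoulli n p =
  \sum_(k < n.+1) (stirling2_rec n k)%:R *
    ((-1) ^+ k * (k`! * k`! * p.+1`!)%:R / (k + p.+1)`!%:R).
Proof.
elim: n p => [|n IHn] p.
  by rewrite big_ord1 !mul1n !mul1r add0n divff // pnatr_eq0 -lt0n fact_gt0.
rewrite (stirling2_sumS n (fun k => (-1) ^+ k *
  (k`! * k`! * p.+1`!)%:R / (k + p.+1)`!%:R)) [LHS]/= !IHn !mulr_sumr -sumrB.
apply: eq_bigr => k _.
rewrite [(k + p.+2)%N]addnS addSn !factS !natrM (exprS _ k).
have f m : m`!%:R != 0 :> rat by rewrite pnatr_eq0 -lt0n fact_gt0.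
have h1 := f (k + p.+1)%N.
rewrite addnS in h1 *; rewrite -!natr1 natrD.
by field; rewrite h1 -natrD !natr1 !pnatr_eq0.
Qed.

Lemma bernoulliE n : bernoulli n = pBernoulli n 0.
Proof.
elim/ltn_ind: n => n IHn.
(* The recurrence determines its last term, whose coefficient C(n+1, n) = n + 1 is nonzero. *)
suff rec : \sum_(k < n.+1) 'C(n.+1, k)%:R * pBernoulli k 0 = (n == 0)%:R.
  move: rec; rewrite -bernoulli_rec !big_ord_recr /= => /esym.
  under eq_bigr => k _ do rewrite IHn //.
  by move/addrI/mulfI; apply; rewrite binSn pnatr_eq0.
pose a k : rat := (-1) ^+ k * k`!%:R / k.+1%:R.
(* A range independent of k allows the sums to be exchanged; the added terms have j > k, where S(k,
   j) = 0. *)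
have BE k : (k <= n)%N ->
    pBernoulli k 0 = \sum_(j < n.+1) (stirling2_rec k j)%:R * a j.
  move=> le_kn; rewrite pBernoulli_stirling2.
  rewrite [LHS](eq_bigr (fun j : 'I__ => (stirling2_rec k j)%:R * a j)).
    rewrite (big_ord_widen n.+1 (fun j => (stirling2_rec k j)%:R * a j)) //.
    rewrite [RHS](bigID (fun j : 'I__ => (j < k.+1)%N)) /=.
    rewrite [X in _ = _ + X]big1 ?addr0 //.
    by move=> j; rewrite -leqNgt => /stirling2_rec_small->; rewrite mul0r.
  move=> j _; congr (_ * _).
  rewrite /a addn1 (factS j) (muln1 (j`! * j`!)) !natrM.
  by field; rewrite nat1r !pnatr_eq0 -!lt0n fact_gt0.
under eq_bigr => k _ do rewrite (BE k) -1?ltnS // mulr_sumr.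
rewrite exchange_big /= -sum_alt_stirling2; apply: eq_bigr => j _.
under eq_bigr => k _ do rewrite mulrA.
(* Without the term k = n + 1 the sum is S(n+2, j+1) - S(n+1, j) = (j+1) S(n+1, j+1), and j + 1
   cancels the denominator of [a j]. *)
have := sum_bin_stirling2 n.+1 j; rewrite big_ord_recr /= binn mul1r.
rewrite stirling2_recSS natrD natrM => /addIr rec; rewrite -mulr_suml rec /a.
by field; rewrite nat1r pnatr_eq0.
Qed.

(** The index n + 1 makes S(n+1, 0) = 0, which removes the term k = 0, whose denominator is zero for
    p = 0. The induction starts from B_(1,p) = -1/(p+2). *)
Lemma pBernoulliS_stirling2 n p :
  pBernoulli n.+1 p =
  p.+1%:R * \sum_(k < n.+2) (stirling2_rec n.+1 k)%:R *
    ((-1) ^+ (n.+1 + k + 1) * k`!%:R / ((k + p)%:R * (k + p + 1)%:R)).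
Proof.
elim: n p => [|n IHn] p.
  rewrite big_ord_recl big_ord1 mul0r add0r lift0 /= -(signr_odd _ (_ + 1)) /=.
  rewrite expr1 !mul1r addn1 add1n -!natr1.
  by field; rewrite !(natr1, nat1r) !pnatr_eq0.
rewrite (stirling2_sumS n.+1 (fun k => (-1) ^+ (n.+2 + k + 1) * k`!%:R /
  ((k + p)%:R * (k + p + 1)%:R))).
have -> m : pBernoulli m.+1 p =
  p%:R * pBernoulli m p - p.+1%:R ^+ 2 / p.+2%:R * pBernoulli m p.+1 by [].
rewrite !IHn !mulr_sumr -sumrB.
apply: eq_bigr => -[[|k] /= _] _; first by rewrite !(mul0r, mulr0) subr0.
move: (stirling2_rec _ _)%:R => s.
rewrite (factS k.+1) natrM; move: (k.+1)`!%:R => f.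
rewrite !(addSn, addnS, addn0) !(exprS (-1)) -!natr1 !natrD.
by field; rewrite -?natrD !(natr1, nat1r) !pnatr_eq0.
Qed.

Theorem theorem2 :
  (forall n p : nat, (1 <= n)%N ->
     pBernoulli n p =
       p.+1%:R * \sum_(1 <= k < n.+1)
         (stirling2 n k)%:R * ((-1) ^+ (n + k + 1) * k`!%:R /
                               ((k + p)%:R * (k + p + 1)%:R)))
  /\
  (forall n : nat, (1 <= n)%N ->
     bernoulli n =
       \sum_(1 <= k < n.+1)
         (stirling2 n k)%:R * ((-1) ^+ (n + k + 1) * (k.-1)`!%:R /
                               (k + 1)%:R)).
Proof.
have pB n p : (1 <= n)%N -> pBernoulli n p =
    p.+1%:R * \sum_(1 <= k < n.+1) (stirling2 n k)%:R *
      ((-1) ^+ (n + k + 1) * k`!%:R / ((k + p)%:R * (k + p + 1)%:R)).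
  case: n => // n _; rewrite pBernoulliS_stirling2 -(big_mkord xpredT
    (fun k => (stirling2_rec n.+1 k)%:R * ((-1) ^+ (n.+1 + k + 1) * k`!%:R /
      ((k + p)%:R * (k + p + 1)%:R)))).
  rewrite big_ltn // mul0r add0r; congr (_ * _).
  by apply: eq_bigr => k _; rewrite stirling2E.
split=> // n n_gt0; rewrite bernoulliE pB // mul1r.
(* For p = 0 the denominator is k (k+1), and k!/k = (k-1)! since k >= 1. *)
apply: eq_big_nat => -[//|k] _; congr (_ * _).
rewrite addn0 factS natrM natrD /= -natr1.
by field; rewrite !(natr1, nat1r) !pnatr_eq0.
Qed.
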